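(* Let $\omega$ be any real function with $\omega(x) \to \infty$ as $x \to \infty$. There exist infinite sets $A, B$ of positive integers such that $A+B$ contains all but finitely many positive integers, $A(x)B(x)/x \to 1$ as $x \to \infty$, and, for some constant $c$, for infinitely many values of $x$ we have \[ A(x)B(x) - x < \min\bigl(\omega(x),\, c\, a^*(x)\bigr). \]
   Context: For a set $S$ of positive integers, $S(x) = \#\{s \in S : s \le x\}$ is its counting function. $A+B = \{a+b : a \in A, b\in B\}$. $a^*(x) = \max\{a \in A : a \le x\}$. *)

(* Defs.v *)
From HB Require Import structures.
From mathcomp Require Import all_boot all_order all_algebra finmap.
From mathcomp Require Import all_classical all_reals all_analysis.

Set Implicit Arguments.
Unset Strict Implicit.
Unset Printing Implicit Defensive.

Import Order.TTheory GRing.Theory Num.Theory.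
Import numFieldNormedType.Exports.

Local Open Scope classical_set_scope.
Local Open Scope ring_scope.

Definition posints : set nat := [set n | (0 < n)%N].

Definition sumset (A B : set nat) : set nat :=
  [set (a + b)%N | a in A & b in B].

Definition upto (R : realType) (S : set nat) (x : R) : set nat :=
  [set s | S s /\ s%:R <= x].

(* [fset_set] is only meaningful on finite sets. *)
Lemma finite_upto (R : realType) (S : set nat) (x : R) :
  finite_set (upto S x).
Proof.
apply: (sub_finite_set _ (finite_II (Num.bound x))) => s [_ sx] /=.
have [x0|x0] := leP 0 x.
  by rewrite -(ltr_nat R); exact: le_lt_trans sx (archi_boundP x0).
by move: (le_lt_trans sx x0); rewrite ltNge ler0n.
Qed.

Definition count_upto (R : realType) (S : set nat) (x : R) : nat :=
  #|` fset_set (upto S x)|.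

(* By convention this is 0 when no element of [A] is at most [x]; for nonempty
   [A] that happens only below [min A]. *)
Definition last_elt (R : realType) (A : set nat) (x : R) : nat :=
  (\max_(a <- fset_set (upto A x)) a)%N.

(* Main.v *)
Require Import Defs.
From HB Require Import structures.
From mathcomp Require Import all_boot all_order all_algebra finmap.
From mathcomp Require Import all_classical all_reals all_analysis.
From mathcomp Require Import zify.

(** Choose [A = {a_0 < a_1 < ...}] growing as fast as we please and such that
    [a_0, ..., a_(m-1)] form a complete residue system modulo [m] whenever
    [2 ^ l %| m <= 4 * 4 ^ l]. While [A] has [m] elements below [x], let [B]
    consist of the multiples of [d], the largest multiple of
    [h = 2 ^ l ~ sqrt m] that is at most [m]; then [A + B] misses nothing and
    [A(x) B(x) / x] is about [m / d = 1 + O(1 / h)].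

    The delicate point is the arrival of a new element [a]. The old multiples
    are kept up to [(h + 1) a], and the new ones start at [h a]: the overlap,
    of length [a], is negligible with respect to [h a], and the delay costs
    about [(m / d - 1) h a], which is [O(a)] because [m - d <= h] and
    [h ^ 2 <= m]. When [m = 4 ^ l] we have [d = m], so no further excess
    accumulates: [A(x) B(x) - x <= 5 a] until the next element of [A], which can
    be delayed until [omega] exceeds [5 a]. *)

Set Implicit Arguments.
Unset Strict Implicit.
Unset Printing Implicit Defensive.

(** * The scale [h] near the square root of [m], and the modulus [d] *)

Definition block (k : nat) : nat := 2 ^ trunc_log 4 k.+1.

Definition modulus (k : nat) : nat := k.+1 %/ block k * block k.

Lemma block_gt0 k : 0 < block k.
Proof. by rewrite expn_gt0. Qed.

Lemma sqr_block k : block k ^ 2 = 4 ^ trunc_log 4 k.+1.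
Proof. by rewrite -expnM mulnC expnM. Qed.

Lemma sqr_block_le k : block k ^ 2 <= k.+1.
Proof. by rewrite sqr_block trunc_logP. Qed.

Lemma ltn_sqr_block k : k.+1 < 4 * block k ^ 2.
Proof. by rewrite sqr_block -expnS trunc_log_ltn. Qed.

Lemma leq_block j k : j <= k -> block j <= block k.
Proof. by move=> jk; rewrite leq_exp2l// leq_trunc_log. Qed.

Lemma block_expn l : block (4 ^ l).-1 = 2 ^ l.
Proof. by rewrite /block prednK ?expn_gt0// trunc_expnK. Qed.

Lemma modulus_le k : modulus k <= k.+1.
Proof. exact: leq_divM. Qed.

Lemma modulus_gt k : k.+1 < modulus k + block k.
Proof. by rewrite {1}(divn_eq k.+1 (block k)) ltn_add2l ltn_mod block_gt0. Qed.

Lemma modulus_gt0 k : 0 < modulus k.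
Proof.
have := modulus_gt k; have := sqr_block_le k; have := block_gt0 k.
by rewrite -mulnn; nia.
Qed.

Lemma modulus_expn l : modulus (4 ^ l).-1 = 4 ^ l.
Proof.
rewrite /modulus block_expn prednK ?expn_gt0// divnK//.
by rewrite dvdn_exp2r.
Qed.

(** * A sequence with complete residue systems and prescribed growth *)

(* Removes the leading binary digit of [i]. *)
Definition strip (i : nat) : nat := i %% 2 ^ trunc_log 2 i.

(* Course-of-values recursion for the equation [offsetS] below: [offset] agrees
   with its value at the stripped index modulo every small number, so modulo
   [m] it depends only on the last binary digits of the index. *)
Fixpoint offset_upto (G : nat -> nat -> nat) (n : nat) : nat -> nat :=
  if n is n'.+1 then
    let f := offset_upto G n' in
    fun k => if k <= n' then f k
             else f (strip n) + (4 * n ^ 2)`! * G n' (f n')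
  else fun=> 0.

Definition offset G n := offset_upto G n n.

Lemma offset_uptoE G n k : k <= n -> offset_upto G n k = offset G k.
Proof.
elim: n => [|n IHn]; first by rewrite leqn0 => /eqP->.
by rewrite leq_eqVlt => /predU1P[->//|kn]; rewrite /= -ltnS kn IHn.
Qed.

Lemma strip_lt i : 0 < i -> strip i < i.
Proof.
move=> i0; rewrite (leq_trans _ (trunc_logP (isT : 1 < 2) i0))//.
by rewrite ltn_mod expn_gt0.
Qed.

Lemma offsetS G n :
  offset G n.+1 = offset G (strip n.+1) + (4 * n.+1 ^ 2)`! * G n (offset G n).
Proof.
rewrite {1}/offset /= ltnn !offset_uptoE//.
by rewrite -ltnS strip_lt.
Qed.

(** While the index is at least [2 ^ l], the factorial in [offsetS] is a multiple of [m], and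
    [strip] deletes a binary digit of weight at least [2 ^ l]; so the recursion runs down to the
    last [l] digits without changing the residue. *)
Lemma offset_mod G l m i : 0 < m -> m <= 4 * (2 ^ l) ^ 2 ->
  offset G i = offset G (i %% 2 ^ l) %[mod m].
Proof.
move=> m0 ml; have [n] := ubnP i; elim: n i => // n IHn i /ltnSE-in_.
have [il|li] := ltnP i (2 ^ l); first by rewrite (modn_small il).
case: i in_ li => [|i] in_ li; first by rewrite mod0n.
rewrite offsetS -modnDmr.
have /eqP-> : m %| (4 * i.+1 ^ 2)`! * G i (offset G i).
  apply/dvdn_mulr/dvdn_fact; rewrite m0 (leq_trans ml)//.
  by rewrite leq_mul2l leq_exp2r.
rewrite addn0 IHn; last exact: leq_trans (strip_lt _) in_.
by rewrite /strip modn_dvdm// dvdn_exp2l// trunc_log_max.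
Qed.

Definition summand G i := i.+1 + offset G i.

(** Equal residues modulo [m] are equal modulo [2 ^ l], so by hypothesis the indices share their
    last [l] digits; then their offsets agree modulo [m] and cancel, leaving [i] and [j] congruent
    modulo [m]. *)
Lemma summand_inj_dvdn G l m : 0 < m -> m <= 4 * (2 ^ l) ^ 2 -> 2 ^ l %| m ->
  {in gtn (2 ^ l) &, injective (fun i => summand G i %% 2 ^ l)} ->
  {in gtn m &, injective (fun i => summand G i %% m)}.
Proof.
move=> m0 ml lm inj_l i j im jm; rewrite /= => eq_ij.
have summand_mod k : summand G k = k.+1 + offset G (k %% 2 ^ l) %[mod m].
  by rewrite /summand -modnDmr (offset_mod _ _ m0 ml) modnDmr.
have low k : summand G (k %% 2 ^ l) = summand G k %[mod 2 ^ l].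
  rewrite -[RHS](modn_dvdm _ lm) summand_mod modn_dvdm// /summand !addSnnS.
  by rewrite modnDml.
have ij : i %% 2 ^ l = j %% 2 ^ l.
  apply: inj_l; rewrite ?inE /= ?ltn_mod ?expn_gt0//.
  by rewrite !low -[LHS](modn_dvdm _ lm) -[RHS](modn_dvdm _ lm) eq_ij.
move: eq_ij; rewrite !summand_mod ij !addSnnS => /eqP.
by rewrite eqn_modDr !modn_small// => /eqP.
Qed.

Lemma summand_inj_mod G l m : 0 < m -> m <= 4 * (2 ^ l) ^ 2 -> 2 ^ l %| m ->
  {in gtn m &, injective (fun i => summand G i %% m)}.
Proof.
move=> m0 ml lm; apply: (summand_inj_dvdn m0 ml lm).
(* Injectivity at the base [2 ^ l] comes by induction: [2 ^ l.+1] is itself a multiple of [2 ^ l]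
   that is at most [4 * (2 ^ l) ^ 2]. *)
elim: l {m0 ml lm} => [[|//] [|//]//|l IHl].
apply: summand_inj_dvdn IHl; rewrite ?expn_gt0 ?dvdn_exp2l//.
by rewrite expnS leq_mul// -mulnn leq_pmulr// expn_gt0.
Qed.

Lemma inj_mod_onto (a : nat -> nat) m n : 0 < m ->
  {in gtn m &, injective (fun i => a i %% m)} ->
  exists2 i, i < m & a i = n %[mod m].
Proof.
move=> m0 inj_a; pose f (i : 'I_m) := Ordinal (ltn_pmod (a i) m0).
have inj_f : injective f.
  by move=> i j [] /inj_a ij; apply/val_inj/ij; rewrite inE /=.
have /codomP[i /(congr1 val) /= ni] : Ordinal (ltn_pmod n m0) \in codom f.
  by rewrite (inj_card_onto inj_f).
by exists i.
Qed.

Lemma summand_onto_mod G k n :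
  exists2 i, i <= k & summand G i = n %[mod modulus k].
Proof.
have [i ik ni] : exists2 i, i < modulus k & summand G i = n %[mod modulus k].
  apply: inj_mod_onto (modulus_gt0 k) _.
  apply: (@summand_inj_mod _ (trunc_log 4 k.+1)) (modulus_gt0 k) _ _.
    by rewrite (leq_trans (modulus_le k))// ltnW// ltn_sqr_block.
  exact: dvdn_mull.
by exists i => //; rewrite -ltnS (leq_trans ik)// modulus_le.
Qed.

Lemma summandS_ge G k : G k (offset G k) <= summand G k.+1.
Proof.
by rewrite /summand offsetS; have := fact_gt0 (4 * k.+1 ^ 2); nia.
Qed.

Lemma exists_summands (F : nat -> nat -> nat) :
  exists a : nat -> nat, [/\ 0 < a 0, forall k, F k (a k) <= a k.+1 &
    forall k n, exists2 i, i <= k & a i = n %[mod modulus k]].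
Proof.
(* The recursion passes only the offset to [G]; adding [k.+1] recovers the element [a k]. *)
exists (summand (fun k t => F k (k.+1 + t))); split=> // k.
  exact: summandS_ge.
exact: summand_onto_mod.
Qed.

(** * The set [B] and the covering property *)

Definition switch (a : nat -> nat) k := (block k).+1 * a k.

(* Stage [k] is when [a 0, ..., a k] are the elements of [A] in use. *)
Definition complement (a : nat -> nat) : set nat :=
  [set b | exists k,
    [/\ modulus k %| b, block k * a k <= b & b < switch a k.+1]].

(** With [m = k.+2] and [h = block k.+1], even all the integers below [switch a k], taken [m] times,
    amount to at most [a k.+1 / h]; the [+ 2] pays for rounding in the two counts of multiples. *)
Definition fast (a : nat -> nat) :=
  0 < a 0 /\ forall k, block k.+1 * k.+2 * (switch a k + 2) <= a k.+1.

Lemma fast_switch a k : fast a -> switch a k + 2 <= a k.+1.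
Proof.
by case=> _ /(_ k); apply: leq_trans; rewrite leq_pmull// muln_gt0 block_gt0.
Qed.

Lemma fast_gt0 a k : fast a -> 0 < a k.
Proof.
by move=> fa; case: k => [|k]; [case: fa | have := fast_switch k fa; lia].
Qed.

Lemma leq_switch a k : a k <= switch a k.
Proof. exact: leq_pmull. Qed.

Lemma fast_ltS a k : fast a -> a k < a k.+1.
Proof. by move=> /(fast_switch k); have := leq_switch a k; lia. Qed.

Lemma fast_mono a : fast a -> {mono a : i j / i <= j}.
Proof.
move=> fa; apply: leq_mono; apply: homo_ltn => [y x z|i].
  exact: ltn_trans.
exact: fast_ltS.
Qed.

Lemma homo_switch a : fast a -> {homo switch a : i j / i <= j}.
Proof.
by move=> fa i j ij; rewrite leq_mul ?ltnS ?leq_block// (fast_mono fa).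
Qed.

Lemma leq_fast_id a k : fast a -> k <= a k.
Proof.
by move=> fa; elim: k => // k /leq_ltn_trans; apply; exact: fast_ltS.
Qed.

Lemma nat_bracket (f : nat -> nat) n : (forall k, k <= f k) -> f 0 <= n ->
  exists k, f k <= n < f k.+1.
Proof.
move=> fge f0n; have ex_k : exists k, n < f k by exists n.+1; exact: fge.
case: (ex_minnP ex_k) => [[|k]]; first by rewrite ltnNge f0n.
move=> nk kmin; exists k; rewrite nk andbT leqNgt; apply/negP => /kmin.
by rewrite ltnn.
Qed.

(** For [n] between two switches, subtracting the congruent [a i] removes at most [a k], so the
    difference is still at least [block k * a k]. This is why consecutive stages must overlap. *)
Lemma complement_sum a n : fast a ->
  (forall k n, exists2 i, i <= k & a i = n %[mod modulus k]) ->
  switch a 0 <= n -> exists i b, complement a b /\ n = a i + b.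
Proof.
move=> fa resa n0.
have [|k /andP[kn nk]] := @nat_bracket (switch a) n _ n0.
  by move=> k; rewrite (leq_trans (leq_fast_id k fa))// leq_switch.
have [i ik /esym/eqP ain] := resa k n.
have aik : a i <= a k by rewrite (fast_mono fa).
have low : block k * a k <= n - a i by move: kn; rewrite /switch mulSn; lia.
have ain' : a i <= n by rewrite (leq_trans aik)// (leq_trans (leq_switch _ _)).
exists i, (n - a i); split; last by rewrite subnKC.
exists k; split=> //; first by rewrite -eqn_mod_dvd.
exact: leq_ltn_trans (leq_subr _ _) nk.
Qed.

(** * Upper bounds for the size of [B] *)

Lemma multiples_between d u v : 0 < d -> exists s : seq nat,
  size s = ((v - u) %/ d).+1 /\
  forall b, d %| b -> u <= b -> b <= v -> b \in s.
Proof.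
move=> d0; set c := (u + d.-1) %/ d.
have uc : u <= c * d.
  have := divn_eq (u + d.-1) d; have := ltn_pmod (u + d.-1) d0.
  by rewrite /c; lia.
exists [seq j * d | j <- iota c ((v - u) %/ d).+1].
split; first by rewrite size_map size_iota.
move=> _ /dvdnP[j ->] uj jv; apply/mapP; exists j => //; rewrite mem_iota.
have cj : c <= j.
  rewrite -ltnS /c ltn_divLR// mulSn; lia.
rewrite cj/= addnS ltnS -leq_subLR leq_divRL// mulnBl; lia.
Qed.

(** Below [a k.+2] no stage after [k.+1] has begun. Stages before [k] stay below [switch a k] and
    are replaced by all integers there, so multiples are counted for two stages only. *)
Lemma complement_list a k n : fast a -> n < a k.+2 -> exists s : seq nat,
  size s = switch a k + (minn n (switch a k.+1) %/ modulus k).+1 +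
           ((n - block k.+1 * a k.+1) %/ modulus k.+1).+1 /\
  forall b, complement a b -> b <= n -> b \in s.
Proof.
move=> fa nk.
have [s [ss sP]] :=
  multiples_between 0 (minn n (switch a k.+1)) (modulus_gt0 k).
have [t [st tP]] :=
  multiples_between (block k.+1 * a k.+1) n (modulus_gt0 k.+1).
exists (iota 0 (switch a k) ++ s ++ t); split.
  by rewrite !size_cat size_iota ss st subn0 addnA.
move=> b [j [db jb bj]] bn; rewrite !mem_cat mem_iota add0n/=.
have [jk|] := ltnP j k.
  by rewrite (leq_trans bj)// homo_switch.
rewrite leq_eqVlt => /predU1P[kj|].
  by rewrite -kj in db bj *; rewrite sP ?orbT// leq_min bn (ltnW bj).
rewrite leq_eqVlt => /predU1P[kj|kj].
  by rewrite -kj in db jb *; rewrite tP ?orbT.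
suff : n < n by rewrite ltnn.
rewrite (leq_trans nk)// (leq_trans _ bn)// (leq_trans _ jb)//.
by rewrite (leq_trans _ (leq_pmull _ (block_gt0 _)))// (fast_mono fa).
Qed.

(** From [m - d <= h] and [h ^ 2 <= m] follows [m / d <= h / (h - 1)], and likewise for [d']. The
    resulting factor [(h + 2) / (h - 1)] tends to 1. *)
Lemma density_arith h m d d' a n M T p q : 1 < h -> h ^ 2 <= m ->
  m <= d + h -> m <= d' + h -> p * d <= M -> q * d' <= n - h * a ->
  M <= n -> M <= h.+1 * a -> h * m * (T + 2) <= a -> a <= n ->
  m * (T + p.+1 + q.+1) * h.-1 <= n * h.+2.
Proof.
move=> h1 hm md md' pM qn Mn Ma ha an.
have hm' d0 : m <= d0 + h -> m * h.-1 <= h * d0 by nia.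
have pq : m * h.-1 * (p + q) <= h * (M + (n - h * a)).
  have := hm' d md; have := hm' d' md'; nia.
(* For [n > h * a] the two ranges overlap in at most [a < n / h]; otherwise the truncated difference
   vanishes. *)
have M2 : h * (M + (n - h * a)) <= h.+1 * n by case: (leqP n (h * a)); nia.
have : m * h.-1 * (T + 2) <= n.
  rewrite (leq_trans _ an)// (leq_trans _ ha)//; nia.
nia.
Qed.

(** The new step is exactly [m], so its multiples cost at most [n - h * a]. The old ones cost at
    most [(h + 4) * a] and the remaining terms at most [a], which gives the 5. *)
Lemma excess_arith h m d a n T p : 1 < h -> h ^ 2 <= m ->
  m <= d + h -> p * d <= h.+1 * a -> h * m * (T + 2) <= a -> h * a <= n ->
  m * (T + p.+1 + ((n - h * a) %/ m).+1) <= n + 5 * a.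
Proof.
move=> h1 hm md pa ha an.
have qn : m * ((n - h * a) %/ m) <= n - h * a by rewrite mulnC leq_divM.
have hm' : m * h.-1 <= h * d by nia.
have pm : m * h.-1 * p <= h * (h.+1 * a) by nia.
(* For [h >= 2], [h * (h + 1) <= (h - 1) * (h + 4)]. *)
have pm' : m * p <= h.+4 * a.
  rewrite -(@leq_pmul2l h.-1); last lia.
  by rewrite mulnA (mulnC h.-1 m) (leq_trans pm)//; nia.
have : m * (T + 2) <= a by rewrite (leq_trans _ ha)//; nia.
nia.
Qed.

Lemma complement_unbounded a k : fast a -> exists2 b, complement a b & k <= b.
Proof.
move=> fa; have := modulus_gt0 k; have := modulus_le k.
set d := modulus k => dk d0; have h0 := block_gt0 k.
have ka := leq_fast_id k fa; exists (d * (block k * a k)); last first.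
  by rewrite mulnA (leq_trans ka)// leq_pmull// muln_gt0 d0.
exists k; rewrite dvdn_mulr// leq_pmull//; split=> //.
case: fa => _ /(_ k) ak; rewrite (leq_trans _ (leq_switch _ _))//.
rewrite (leq_trans _ ak)// -mulnA.
rewrite (leq_trans _ (leq_pmull _ (block_gt0 _)))//.
rewrite (@leq_ltn_trans (k.+2 * switch a k))//; last first.
  by rewrite ltn_mul2l addn2 ltnS leqnSn.
by rewrite leq_mul ?(leq_trans dk)// leq_mul.
Qed.

Import Order.TTheory GRing.Theory Num.Theory.
Import numFieldNormedType.Exports.

Local Open Scope classical_set_scope.
Local Open Scope ring_scope.

(** * Counting functions at real arguments *)

Lemma mem_upto (R : realType) (S : set nat) (x : R) b :
  (b \in fset_set (upto S x)) = `[< S b /\ b%:R <= x >].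
Proof. by rewrite in_fset_set ?inE//; exact: finite_upto. Qed.

Lemma count_upto_le (R : realType) (S : set nat) (x : R) (s : seq nat) :
  (forall b, S b -> b%:R <= x -> b \in s) -> (count_upto S x <= size s)%N.
Proof.
move=> Ss; apply: uniq_leq_size; first exact: fset_uniq.
by move=> b; rewrite mem_upto => /asboolP[]; exact: Ss.
Qed.

Lemma count_upto_range (R : realType) (a : nat -> nat) k (x : R) :
  {mono a : i j / (i <= j)%N} -> (a k)%:R <= x < (a k.+1)%:R ->
  count_upto (range a) x = k.+1.
Proof.
move=> amono /andP[kx xk].
have a_lt := leqW_mono amono.
apply/eqP; rewrite eqn_leq; apply/andP; split.
  rewrite -[k.+1](size_iota 0) -(size_map a).
  apply: count_upto_le => _ [i _ <-] ix.
  by rewrite map_f// mem_iota/= add0n -a_lt -(ltr_nat R) (le_lt_trans ix).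
rewrite -[k.+1](size_iota 0) -(size_map a); apply: uniq_leq_size.
  by rewrite map_inj_uniq ?iota_uniq//; exact: incn_inj.
move=> _ /mapP[i + ->]; rewrite mem_iota/= add0n ltnS => ik.
rewrite mem_upto; apply/asboolP; split; first by exists i.
by rewrite (le_trans _ kx)// ler_nat amono.
Qed.

(** Each integer from [n0] to [N] needs its own pair of summands, both at most [x]. *)
Lemma count_sumset_ge (R : realType) (A B : set nat) n0 N (x : R) :
  (forall n, (n0 <= n)%N -> sumset A B n) -> N%:R <= x ->
  (N.+1 - n0 <= count_upto A x * count_upto B x)%N.
Proof.
move=> cover Nx.
rewrite -(size_iota n0 (_ - _)) /count_upto -(size_allpairs addn).
apply: uniq_leq_size; first exact: iota_uniq.
move=> n; rewrite mem_iota => /andP[n0n nN].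
have [p Ap [q Bq pq]] := cover n n0n.
have nx : n%:R <= x by rewrite (le_trans _ Nx)// ler_nat; lia.
by apply/allpairsP; exists (p, q); split=> //=; rewrite mem_upto; apply/asboolP;
  split=> //; rewrite (le_trans _ nx)// ler_nat -pq ?leq_addr ?leq_addl.
Qed.

Lemma infinite_unbounded (S : set nat) :
  (forall k, exists2 n, S n & (k <= n)%N) -> infinite_set S.
Proof.
move=> unb finS; have [n Sn] := unb (\max_(i <- fset_set S) i).+1.
by rewrite ltnNge leq_bigmax_seq// in_fset_set// inE.
Qed.

Lemma count_complement_le (R : realType) a k (x : R) : fast a ->
  (1 < block k.+1)%N -> (a k.+1)%:R <= x < (a k.+2)%:R ->
  (k.+2 * count_upto (complement a) x * (block k.+1).-1
    <= Num.truncn x * (block k.+1).+2)%N.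
Proof.
move=> fa h1 /andP[kx xk]; set n := Num.truncn x.
have x0 : 0 <= x by rewrite (le_trans _ kx).
have kn : (a k.+1 <= n)%N by rewrite truncn_ge_nat.
have nk : (n < a k.+2)%N by rewrite truncn_lt_nat.
have [s [ss sP]] := complement_list fa nk.
have cB : (count_upto (complement a) x <= size s)%N.
  by apply: count_upto_le => b Bb bx; rewrite sP// truncn_ge_nat.
rewrite (@leq_trans (k.+2 * size s * (block k.+1).-1))//.
  by rewrite leq_mul2r leq_mul2l cB !orbT.
rewrite ss; apply: (density_arith (a := a k.+1) h1 (sqr_block_le _)
  (d := modulus k) (d' := modulus k.+1) (M := minn n (switch a k.+1))) => //.
(* Stage [k] has one element fewer; the strictness in [modulus_gt] absorbs the difference. *)
- have := modulus_gt k; have := leq_block (leqnSn k); lia.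
- exact: ltnW (modulus_gt _).
- exact: leq_divM.
- exact: leq_divM.
- exact: geq_minl.
- exact: geq_minr.
- by case: fa.
Qed.

(** When the number of elements is a power of 4, stage [k.+1] has modulus exactly [k.+2], so the
    excess has not grown by the last moment before [a k.+2]. *)
Lemma count_complement_exact (R : realType) a k l : fast a -> (0 < l)%N ->
  k.+2 = (4 ^ l)%N ->
  (k.+2 * count_upto (complement a) ((a k.+2).-1%:R : R)
    <= (a k.+2).-1 + 5 * a k.+1)%N.
Proof.
move=> fa l0 kl; set n := (a k.+2).-1.
have k1E : k.+1 = (4 ^ l).-1 by rewrite -kl.
have nk : (n < a k.+2)%N by rewrite prednK// fast_gt0.
have [s [ss sP]] := complement_list fa nk.
have cB : (count_upto (complement a) (n%:R : R) <= size s)%N.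
  by apply: count_upto_le => b Bb; rewrite ler_nat => bn; rewrite sP.
have dE : modulus k.+1 = k.+2 by rewrite k1E modulus_expn -k1E kl.
rewrite (@leq_trans (k.+2 * size s))//; first by rewrite leq_mul2l cB.
rewrite ss dE; apply: (excess_arith (d := modulus k)).
- by rewrite k1E block_expn -{1}(expn0 2) ltn_exp2l.
- exact: sqr_block_le.
- have := modulus_gt k; have := leq_block (leqnSn k); lia.
- by rewrite (leq_trans (leq_divM _ _))// geq_minr.
- by case: fa.
- by have := fast_switch k.+1 fa; rewrite /switch mulSn /n; lia.
Qed.

(** * Convergence of the ratio *)

Lemma block_unbounded K : exists k0, forall k, (k0 <= k)%N -> (K < block k)%N.
Proof.
exists (4 ^ K).-1 => k /leq_block; apply: leq_trans.
by rewrite block_expn ltn_expl.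
Qed.

Lemma count_ratio_cvg (R : realType) a n0 : fast a ->
  (forall n, (n0 <= n)%N -> sumset (range a) (complement a) n) ->
  (count_upto (range a) x)%:R * (count_upto (complement a) x)%:R / x
    @[x --> +oo] --> (1 : R).
Proof.
move=> fa cover; apply/cvgrPdist_le => e e0.
(* Since [(h + 2) / (h - 1) = 1 + 3 / (h - 1)], it is enough that [h - 1 >= 3 / e]. *)
have [k0 hk0] := block_unbounded (Num.truncn (3 / e)).+2.
near=> x.
have x0 : 0 < x by near: x; apply: nbhs_pinfty_gt.
have [j /andP[jn nj]] : exists j, (a j <= Num.truncn x < a j.+1)%N.
  apply: nat_bracket => [k|]; first exact: leq_fast_id.
  rewrite truncn_ge_nat ?(ltW x0)//.
have k0j : (k0.+1 <= j)%N.
  rewrite -ltnS -(leqW_mono (fast_mono fa)) (leq_trans _ nj)// ltnS.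
  rewrite truncn_ge_nat ?(ltW x0)//.
case: j jn nj k0j => // k kn nk k0k.
have kx : (a k.+1)%:R <= x < (a k.+2)%:R.
  by rewrite -truncn_ge_nat ?(ltW x0)// kn -truncn_lt_nat ?(ltW x0).
have hK : ((Num.truncn (3 / e)).+2 < block k.+1)%N.
  by rewrite hk0// ltnW.
have h1 : (1 < block k.+1)%N by rewrite (leq_trans _ hK).
have := count_complement_le fa h1 kx.
have nx : (Num.truncn x)%:R <= x by case/andP: (truncn_itv (ltW x0)).
have := count_sumset_ge cover nx.
rewrite (count_upto_range (fast_mono fa) kx) -natrM.
set c := (k.+2 * _)%N => lo up.
have {}lo : x - n0%:R <= c%:R.
  have : x < (Num.truncn x).+1%:R by case/andP: (truncn_itv (ltW x0)).
  rewrite lerBlDl -natrD => /ltW/le_trans; apply.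
  by rewrite ler_nat -leq_subLR.
have {up} : c%:R <= x * (1 + e).
  have g1 : 1 <= (block k.+1).-1%:R :> R by rewrite ler1n; lia.
  rewrite -(ler_pM2r (lt_le_trans ltr01 g1)).
  have g3 : 3 <= e * (block k.+1).-1%:R.
    rewrite mulrC -ler_pdivrMr//.
    have e3 : 0 <= 3 / e by rewrite divr_ge0// ltW.
    have /andP[_ /ltW/le_trans->//] := truncn_itv e3.
    by rewrite ler_nat -ltnS prednK ?block_gt0// ltnW.
  have hg : (block k.+1).+2%:R = (block k.+1).-1%:R + 3 :> R.
    by rewrite -natrD; congr (_%:R); lia.
  move: up; rewrite -(ler_nat R) !natrM hg => /le_trans->//.
  rewrite (le_trans (ler_wpM2r (addr_ge0 (ler0n _ _) (ler0n _ _)) nx))//.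
  by rewrite -mulrA ler_pM2l// mulrDl mul1r lerD2l.
have n0x : n0%:R <= e * x.
  by rewrite mulrC -ler_pdivrMr//; near: x; apply: nbhs_pinfty_ge.
move=> up; rewrite ler_distlC ler_pdivlMr// ler_pdivrMr//.
rewrite (mulrC (1 + e)) up andbT.
by rewrite mulrBl mul1r (le_trans _ lo)// lerD2l lerN2.
Unshelve. all: by end_near.
Qed.

(** * Choosing [A] against [omega] *)

(** Recasts the divergence of [omega] as a function on naturals, which can enter the growth
    condition imposed on [a]. *)
Lemma omega_threshold (R : realType) (omega : R -> R) :
  omega x @[x --> +oo] --> +oo ->
  exists w : nat -> nat, forall v n : nat, (w v <= n)%N -> v%:R < omega n%:R.
Proof.
move=> /cvgryPgt oo.
suff /choice[w ww] : forall v : nat, exists w : nat, forall n : nat,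
  (w <= n)%N -> v%:R < omega n%:R by exists w.
move=> v; have [M [_ HM]] := oo v%:R.
exists (Num.truncn `|M|).+1 => n Mn; apply: HM.
rewrite (le_lt_trans (ler_norm M))//.
by rewrite -truncn_lt_nat.
Qed.

Theorem theorem3 (R : realType) (omega : R -> R)
    (omega_oo : omega x @[x --> +oo] --> +oo) :
  exists A B : set nat,
    [/\ (A `<=` posints /\ infinite_set A),
        (B `<=` posints /\ infinite_set B),
        finite_set (posints `\` sumset A B),
        (count_upto A x)%:R * (count_upto B x)%:R / x @[x --> +oo] --> (1 : R) &
        exists c : R,
          infinite_set [set n : nat |
            (count_upto A (n%:R : R))%:R * (count_upto B (n%:R : R))%:R - n%:R
              < Num.min (omega n%:R) (c * (last_elt A (n%:R : R))%:R)]].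
Proof.
have [w ww] := omega_threshold omega_oo.
(* The first bound yields [fast]; the second makes [omega] exceed [5 * a k] already at
   [(a k.+1).-1], whence the successor. *)
have [a [a0 aF resa]] := exists_summands (fun k t =>
  maxn (block k.+1 * k.+2 * ((block k).+1 * t + 2)) (w (5 * t)).+1).
have fa : fast a by split=> // k; move: (aF k); rewrite geq_max => /andP[].
have aw k : (w (5 * a k) < a k.+1)%N.
  by move: (aF k); rewrite geq_max => /andP[].
have cover n : (switch a 0 <= n)%N -> sumset (range a) (complement a) n.
  move=> /(complement_sum fa resa)[i [b [Bb ->]]].
  by exists (a i); [exists i|exists b].
exists (range a), (complement a); split.
- split=> [_ [k _ <-]|]; first exact: fast_gt0.
  apply: infinite_unbounded => k; exists (a k); first by exists k.
  exact: leq_fast_id.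
- split=> [b [k [_ + _]]|].
    by apply: leq_trans; rewrite muln_gt0 block_gt0 fast_gt0.
  by apply: infinite_unbounded => k; exact: complement_unbounded.
- apply: sub_finite_set (finite_II (switch a 0)) => n [_ /= ncov].
  by rewrite ltnNge; apply/negP => /cover.
- exact: count_ratio_cvg cover.
(* The excess is at most 5 times the last element, which is positive, so 6 makes the inequality
   strict. The points used lie just before [a k.+2] with [k.+2] a power of 4. *)
exists 6; apply: infinite_unbounded => K.
pose k := (4 ^ K.+1).-2; have kE : k.+2 = (4 ^ K.+1)%N.
  by rewrite /k expnS; have := expn_gt0 4 K; lia.
have Kk : (K < k.+2)%N by rewrite kE ltnW// ltn_expl.
have a_bounds : (a k.+1)%:R <= ((a k.+2).-1%:R : R) < (a k.+2)%:R.
  by rewrite ler_nat ltr_nat; have := fast_ltS k.+1 fa; lia.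
exists (a k.+2).-1 => /=; last first.
  by rewrite -ltnS prednK ?fast_gt0// (leq_trans Kk)// leq_fast_id.
rewrite (count_upto_range (fast_mono fa) a_bounds) -natrM ltrBlDl.
have /(_ R) := count_complement_exact _ fa (ltn0Sn K) kE.
rewrite -(ler_nat R) natrD => /le_lt_trans; apply.
rewrite ltrD2l lt_min; apply/andP; split.
  by apply: ww; rewrite -ltnS prednK ?fast_gt0.
have last_ge : (a k.+1 <= last_elt (range a) ((a k.+2).-1%:R : R))%N.
  apply: (leq_bigmax_seq (F := id)) => //; rewrite mem_upto; apply/asboolP.
  by split; [exists k.+1|case/andP: a_bounds].
by rewrite -natrM ltr_nat; have := fast_gt0 k.+1 fa; lia.
Qed.
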